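(* There exists a (nonzero) family of linear operators $\mathcal{R}_2=\mathcal{R}_2(u_1,u_2|v_2)$ on $\mathbb{C}[z_1,z_2]$, depending only on $u_1,u_2,v_2$ (not on $v_1$) and satisfying the shift invariance $$\mathcal{R}_2(u_1,u_2|v_2)=\mathcal{R}_2(u_1+\lambda,u_2+\lambda|v_2+\lambda)\quad\text{for all }\lambda\in\mathbb{C},$$ which solves, for all generic $u_1,u_2,v_1,v_2$, the defining equations $$\mathcal{R}_{2}\,\mathrm{L}_{1}(u_1,u_2)\,\mathrm{L}_{2}(v_1,v_2)=\mathrm{L}_{1}(u_1,v_2)\,\mathrm{L}_{2}(v_1,u_2)\,\mathcal{R}_{2}.$$ These requirements fix the operator $\mathcal{R}_2$ up to an overall normalization constant (a scalar, which may depend on the parameters): up to such a factor, $$\mathcal{R}_2(u_1,u_2|v_2)\sim\frac{\Gamma(z_{12}\partial_1+u_1-v_2)}{\Gamma(z_{12}\partial_1+u_1-u_2)},\qquad z_{12}=z_1-z_2 .$$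
   Context: Notation: $\partial_k=\partial/\partial z_k$. For complex parameters $a,b$ and $k\in\{1,2\}$ the Lax operator is the $2\times2$ matrix of differential operators on $\mathbb{C}[z_1,z_2]$ $$\mathrm{L}_k(a,b)=\begin{pmatrix} a+z_k\partial_k & -\partial_k\\ z_k^2\partial_k+(a-b)z_k & b-z_k\partial_k\end{pmatrix}.$$ Products of such matrices are matrix products with operator entries, $(\mathrm{L}_1\mathrm{L}_2)_{ik}=\sum_j(\mathrm{L}_1)_{ij}(\mathrm{L}_2)_{jk}$, and an operator on $\mathbb{C}[z_1,z_2]$ placed to the left or right of a matrix multiplies (composes with) each entry from that side. Parameters are complex and generic: no pairwise difference of $u_1,u_2,v_1,v_2$ is an integer. The operator $z_{12}\partial_1$ is diagonalizable on $\mathbb{C}[z_1,z_2]$: $z_2^j z_{12}^k$ ($j,k\ge0$) is an eigenvector with eigenvalue $k$. For a function $f$ on $\{0,1,2,\dots\}$, $f(z_{12}\partial_1)$ is the operator $z_2^jz_{12}^k\mapsto f(k)z_2^jz_{12}^k$; the Gamma-function quotient is understood in this sense. *)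

(* Defs.v *)
From HB Require Import structures.
From mathcomp Require Import all_boot all_order all_algebra.
From mathcomp Require Import boolp classical_sets reals topology normedtype.
From mathcomp Require Import sequences exp trigo complex.
(* The notations of mpoly are incompatible with those of MathComp-Analysis. *)
From mathcomp Require Import -(notations) mpoly.

Set Implicit Arguments.
Unset Strict Implicit.
Unset Printing Implicit Defensive.

Import Order.TTheory GRing.Theory Num.Theory numFieldNormedType.Exports.

Local Open Scope ring_scope.
Local Open Scope complex_scope.
Local Open Scope classical_set_scope.

Section Gamma.
Variable R : realType.

(* n ^ z = exp (z ln n), for n > 0 *)
Definition natpowC (n : nat) (z : R[i]) : R[i] :=
  (expR (complex.Re z * ln n%:R))%:C
  * (cos (complex.Im z * ln n%:R) +i* sin (complex.Im z * ln n%:R)).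

Definition gauss_seq (z : R[i]) (n : nat) : R[i]^o :=
  n`!%:R * natpowC n z / \prod_(0 <= k < n.+1) (z + k%:R).

(* Gauss' form of the Gamma function: the limit exists at every complex z
   other than 0, -1, -2, ... (at those poles the value is a dummy one). *)
Definition GammaC (z : R[i]) : R[i] := limn (gauss_seq z).

End Gamma.

Notation poly2 R := (mpoly 2 R[i]).

Notation operator R := (poly2 R -> poly2 R).

Section Operators.
Variable R : realType.
Local Notation C := R[i].
Local Notation P := (poly2 R).
Local Notation op := (operator R).

(* The variables z_1, z_2 are indexed by 0, 1 : 'I_2. *)
Definition zvar (k : 'I_2) : P := mpolyX C (mnm1 k).
Definition z12 : P := zvar 0 - zvar 1.

Definition opmx2 (A B C D : op) : 'M[op]_2 :=
  \matrix_(i < 2, j < 2)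
    if i == 0 then (if j == 0 then A else B) else (if j == 0 then C else D).

Definition opmx_mul (A B : 'M[op]_2) : 'M[op]_2 :=
  \matrix_(i < 2, k < 2) fun p => \sum_(j < 2) A i j (B j k p).

Definition opmx_scalel (T : op) (A : 'M[op]_2) : 'M[op]_2 :=
  map_mx (fun X : op => T \o X) A.

Definition opmx_scaler (A : 'M[op]_2) (T : op) : 'M[op]_2 :=
  map_mx (fun X : op => X \o T) A.

Definition Lax (k : 'I_2) (a b : C) : 'M[op]_2 :=
  opmx2 (fun p => a *: p + zvar k * mderiv k p)
        (fun p => - mderiv k p)
        (fun p => zvar k ^+ 2 * mderiv k p + (a - b) *: (zvar k * p))
        (fun p => b *: p - zvar k * mderiv k p).

(* Substituting z_1 := z_1 + z_2 in p yields the polynomial whose coefficient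
   at z_1 ^ k z_2 ^ j is that of p on the basis vector z_2 ^ j z_12 ^ k. *)
Definition z12_coords (p : P) : P :=
  comp_mpoly [tuple zvar 0 + zvar 1; zvar 1] p.

(* f(z_12 d_1); see fun_z12d1E, fun_z12d1_is_linear. *)
Definition fun_z12d1 (f : nat -> C) : op := fun p =>
  \sum_(m <- msupp (z12_coords p))
    (f (m 0) * mcoeff m (z12_coords p)) *: (zvar 1 ^+ (m 1) * z12 ^+ (m 0)).

Definition generic (s : seq C) : Prop :=
  forall i j : nat, (i < j < size s)%N -> forall m : int, s`_i - s`_j != m%:~R.

(* A family R_2(u1, u2 | v2); its values are only meaningful at generic
   parameters. *)
Definition op_family := C -> C -> C -> {linear P -> P}.

Definition nonzero_op (T : op) : Prop := exists p, T p != 0.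

Definition nonzero_family (R2 : op_family) : Prop :=
  forall u1 u2 v2, generic [:: u1; u2; v2] -> nonzero_op (R2 u1 u2 v2).

Definition shift_invariant (R2 : op_family) : Prop :=
  forall u1 u2 v2, generic [:: u1; u2; v2] ->
  forall lambda : C,
    R2 u1 u2 v2 =1 R2 (u1 + lambda) (u2 + lambda) (v2 + lambda).

Definition solves_defining_equations (R2 : op_family) : Prop :=
  forall u1 u2 v1 v2, generic [:: u1; u2; v1; v2] ->
    opmx_scalel (R2 u1 u2 v2) (opmx_mul (Lax 0 u1 u2) (Lax 1 v1 v2))
    = opmx_scaler (opmx_mul (Lax 0 u1 v2) (Lax 1 v1 u2)) (R2 u1 u2 v2).

Definition GammaQuotient (u1 u2 v2 : C) : op :=
  fun_z12d1 (fun k => GammaC (k%:R + u1 - v2) / GammaC (k%:R + u1 - u2)).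

Lemma z12d1E (j k : nat) :
  z12 * mderiv 0 (zvar 1 ^+ j * z12 ^+ k) = k%:R *: (zvar 1 ^+ j * z12 ^+ k).
Proof.
have D1 i n (q : P) : mderiv i (q ^+ n) = q ^+ n.-1 * mderiv i q *+ n.
  elim: n => [|n IH]; first by rewrite expr0 mulr0n -mpolyC1 mderivC.
  rewrite exprS mderivM IH /=; case: n {IH} => [|n] /=.
    by rewrite expr0 mulr1 mulr0n mulr0 addr0 mul1r.
  by rewrite mulrnAr mulrA -exprS mulrC -mulrS.
rewrite mderivM !D1 /z12 linearB /= /zvar !mderivX !mnm1E /=.
rewrite !mulr0n !scale0r !mulr0 !mul0rn mul0r add0r subr0 !mulr1n scale1r.
have -> : mnm_sub (mnm1 (0 : 'I_2)) (mnm1 0) = mnm0 by apply/mnmP=> i; rewrite mnmBE mnm0E subnn.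
rewrite mpolyX0 mulr1 scaler_nat; case: k => [|k]; first by rewrite !mulr0n !mulr0.
by rewrite /= !mulrnAr mulrCA -exprS.
Qed.

Lemma z12_coordsE (j k : nat) :
  z12_coords (zvar 1 ^+ j * z12 ^+ k)
  = mpolyX C (mnm_add (mnm_muln (mnm1 0) k) (mnm_muln (mnm1 1) j)).
Proof.
rewrite /z12_coords rmorphM !rmorphXn /z12 rmorphB /= !comp_mpolyXU /= addrK.
by rewrite mpolyXD !mpolyXn mulrC.
Qed.

Lemma fun_z12d1_is_linear (f : nat -> C) : linear (fun_z12d1 f).
Proof.
pose F (s : P) : P := \sum_(m <- msupp s)
  (f (m 0) * mcoeff m s) *: (zvar 1 ^+ (m 1) * z12 ^+ (m 0)).
have F_bound (s : P) (b : nat) : (mmeasure mdeg s <= b)%N ->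
    F s = \sum_(m : bmultinom 2 b)
      (f (bmnm m 0) * mcoeff m s) *: (zvar 1 ^+ (bmnm m 1) * z12 ^+ (bmnm m 0)).
  move=> sb; rewrite /F; pose I : subFinType _ := bmultinom 2 b.
  rewrite (ssrcomplements.big_mksub I) /=; first last.
  - by move=> m /msize_mdeg_lt /leq_trans; apply.
  - by rewrite msupp_uniq.
  rewrite big_rmcond //= => m /memN_msupp_eq0 ->.
  by rewrite mulr0 scale0r.
have F_linear c (s t r : P) :
    (forall m, mcoeff m r = c * mcoeff m s + mcoeff m t) -> F r = c *: F s + F t.
  move=> rE; pose b := (mmeasure mdeg s + (mmeasure mdeg t + mmeasure mdeg r))%N.
  have sb : (mmeasure mdeg s <= b)%N by rewrite leq_addr.
  have tb : (mmeasure mdeg t <= b)%N by rewrite /b addnCA leq_addr.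
  have rb : (mmeasure mdeg r <= b)%N by rewrite /b addnA leq_addl.
  rewrite (F_bound s b sb) (F_bound t b tb) (F_bound r b rb).
  rewrite scaler_sumr -big_split; apply: eq_bigr => m _.
  by rewrite rE /= scalerA -scalerDl mulrDr (mulrCA c).
move=> c p q; apply: F_linear => m.
by rewrite /z12_coords comp_mpolyD comp_mpolyZ mcoeffD mcoeffZ.
Qed.

Lemma fun_z12d1E (f : nat -> C) (j k : nat) :
  fun_z12d1 f (zvar 1 ^+ j * z12 ^+ k) = f k *: (zvar 1 ^+ j * z12 ^+ k).
Proof.
rewrite /fun_z12d1 z12_coordsE msuppX big_seq1 mcoeffX eqxx mulr1.
by rewrite !mnmDE !mulmnE !mnm1E /= !mul1n !mul0n addn0 add0n.
Qed.

End Operators.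

(* Main.v *)
Require Import Defs.
From HB Require Import structures.
From mathcomp Require Import all_boot all_order all_algebra.
From mathcomp Require Import boolp classical_sets reals topology normedtype.
From mathcomp Require Import sequences derive realfun exp trigo complex.
From mathcomp Require Import -(notations) mpoly.
From mathcomp Require Import ring lra.

(** In the coordinates [x = z_12], [y = z_2] put [D = x d_x], so that
    [y ^ j x ^ k] is an eigenbasis of [D].  Since [d_1 = d_x] and
    [d_2 = d_y - d_x], all four entries of [L_1(u1, u2) L_2(v1, v2)] are built
    from the operators
      [D + u1],
      [lower = (D + u1 - v2) d_x - (D + u1) d_y],
      [raise = y (D + u1) + x (D + u1 - u2)],
    and from [corner], which is made of the same pieces ([entry00], ...,
    [entry11]).  The entries in the first column are affine in [v1], with
    slopes [D + u1] and [raise]; the right-hand side of the defining equations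
    has the same form with [u2] and [v2] exchanged.

    Existence.  An operator [f(D)] commutes with [D], [y] and [d_y].  It
    intertwines the parts of [lower] and [raise] that shift the eigenvalue as
    soon as
      [f (k + 1) (k + u1 - u2) = f k (k + u1 - v2)],
    and this is all that the four equations require ([fun_z12d1_solves]).
    The Gamma quotient satisfies this recurrence because
    [Gamma (z + 1) = z Gamma z].

    Uniqueness.  A solution [T] does not depend on [v1]; comparing the
    equations at [v1] and [v1 + 1] isolates the slopes.  By shift invariance [T]
    also satisfies the equations with all parameters raised by one; comparing
    these with the original ones, [T] commutes with [d_y] and with [y].  What
    remains of the slope [raise] is [T x (D + u1 - u2) = x (D + u1 - v2) T].
    The polynomial [T 1] is killed by [x d_x] and by [d_y], so it is a constant;
    the last relation then gives [T (x ^ k)] by recursion on [k], with the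
    recurrence of [f], and commutation with [y] gives the rest of the basis
    ([intertwiner_eq]).

    The Gamma function being defined as the limit of Gauss' sequence, one also
    needs that this limit exists and is not zero away from the poles
    ([GammaC_cvg]): the ratio of two consecutive terms is [1 + O(1 / n^2)], and
    the same is true of the inverse sequence. *)

Set Implicit Arguments.
Unset Strict Implicit.
Unset Printing Implicit Defensive.

Import Order.TTheory GRing.Theory Num.Theory numFieldNormedType.Exports.
Import Normc.

Local Open Scope ring_scope.
Local Open Scope complex_scope.
Local Open Scope classical_set_scope.

(** * Sequences with multiplicatively summable increments *)

Section FieldLimits.
Variable K : numFieldType.
Implicit Types (f g h : nat -> K^o) (a b c d : K).

Lemma cvg_neq0_of_inv f a b : (forall n, f n != 0) ->
  f @ \oo --> (a : K^o) -> (fun n => (f n)^-1 : K^o) @ \oo --> (b : K^o) -> a != 0.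
Proof.
move=> f0 fa fb; apply/negP => /eqP a0.
have : (fun n => f n * (f n)^-1 : K^o) @ \oo --> (a * b : K^o) by exact: cvgM.
rewrite (_ : (fun n => _) = fun=> (1 : K^o)); last first.
  by apply/funext => n; rewrite divff.
move/(cvg_unique (@norm_hausdorff _ _) (@cvg_cst _ (1 : K^o) _ _ _)).
by rewrite a0 mul0r => /eqP; rewrite oner_eq0.
Qed.

(** This turns the relation between the Gauss sequences at [z] and [z + 1] into
    the functional equation of Gamma. *)
Lemma lim_of_shift_quotient f g h a b c d :
  f @ \oo --> (a : K^o) -> g @ \oo --> (b : K^o) -> h @ \oo --> (0 : K^o) ->
  (forall n, g n.+1 = c * f n.+1 / (1 + d * h n)) -> b = c * a.
Proof.
move=> fa gb h0 gE.
have : (fun n => g n.+1) @ \oo --> (c * a : K^o).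
  rewrite (_ : (fun n => _) = fun n => c * f n.+1 * (1 + d * h n)^-1); last first.
    by apply/funext => n; exact: gE.
  rewrite -[c * a]mulr1; apply: cvgM.
    apply: cvgM; first exact: cvg_cst.
    by rewrite (@cvg_shiftS K^o f).
  rewrite -[X in _ --> X]invr1; apply: cvgV; first exact: oner_neq0.
  rewrite -[X in _ --> X]addr0; apply: cvgD; first exact: cvg_cst.
  by rewrite -(mulr0 d); apply: cvgM => //; exact: cvg_cst.
rewrite (@cvg_shiftS K^o g) => gca.
exact: (cvg_unique (@norm_hausdorff _ _) gb gca).
Qed.

End FieldLimits.

Section ComplexSequences.
Variable R : realType.
Implicit Types z w : R[i].

Lemma normc_ge0 z : 0 <= normc z.
Proof. by case: z => a b; exact: sqrtr_ge0. Qed.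

Lemma normcD_le z w : normc (z + w) <= normc z + normc w.
Proof. exact: (@le_normcD R). Qed.

Lemma normc_opp z : normc (- z) = normc z.
Proof. exact: (@normcN R). Qed.

Lemma normc_le (a b : R) : normc (a +i* b) <= `|a| + `|b|.
Proof.
have : normc (a +i* b) ^+ 2 <= (`|a| + `|b|) ^+ 2.
  rewrite /= sqr_sqrtr ?addr_ge0 ?sqr_ge0 //.
  rewrite -(real_normK (num_real a)) -(real_normK (num_real b)).
  have := normr_ge0 a; have := normr_ge0 b; nra.
by rewrite ler_pXn2r // nnegrE ?normc_ge0 ?addr_ge0.
Qed.

Lemma cvg_complex (u : nat -> R[i]^o) (a b : R) :
  (fun n => complex.Re (u n)) @ \oo --> a ->
  (fun n => complex.Im (u n)) @ \oo --> b ->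
  u @ \oo --> (a +i* b : R[i]^o).
Proof.
move=> ua ub; apply/cvgrPdist_lt => e e0.
have [e' e'0 ->] : exists2 e' : R, 0 < e' & e = e'%:C.
  exists (complex.Re e); last by rewrite RRe_real // gtr0_real.
  by move: e0; rewrite ltcE => /andP[].
have e2 : 0 < e' / 2 by lra.
near=> n.
have : `|a - complex.Re (u n)| < e' / 2 by near: n; move/cvgrPdist_lt: ua; apply.
have : `|b - complex.Im (u n)| < e' / 2 by near: n; move/cvgrPdist_lt: ub; apply.
case: (u n) => x y /= hy hx.
have -> : (a +i* b) - (x +i* y) = (a - x)%:C + 'i * (b - y)%:C :> R[i] by simpc.
apply: le_lt_trans (ler_normD _ _) _.
rewrite normrM !normc_def /= !expr0n /= !addr0 expr1n add0r !sqrtr_sqr sqrtr1 mul1r.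
rewrite -rmorphD ltcR /=; lra.
Unshelve. all: by end_near.
Qed.

(** Comparable to [1 / n ^ 2], with telescoping partial sums. *)
Definition rate (n : nat) : R := (n.+1%:R * n.+2%:R)^-1.

Lemma rateE n : rate n = n.+1%:R^-1 - n.+2%:R^-1.
Proof. by rewrite /rate -!natr1; field; rewrite !natr1 !pnatr_eq0. Qed.

Lemma series_rate n : series rate n = 1 - n.+1%:R^-1.
Proof.
elim: n => [|n IH]; first by rewrite /series /= big_geq // invr1 subrr.
by rewrite seriesSr IH rateE; ring.
Qed.

Lemma cvg_series_rate : cvgn (series rate).
Proof.
apply/cvg_ex; exists (1 - 0).
rewrite (_ : series rate = fun n => 1 - harmonic n); last first.
  by apply/funext => n; rewrite series_rate.
by apply: cvgB; [exact: cvg_cst | exact: cvg_harmonic].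
Qed.

Lemma is_cvg_of_summable_diff (u : nat -> R) (M : R) :
  (forall n, `|u n.+1 - u n| <= M * rate n) -> cvgn u.
Proof.
move=> h.
have c : cvgn (series (fun n => u n.+1 - u n)).
  apply: normed_cvg; apply: (@series_le_cvg _ _ (fun n => M * rate n)) => //.
  - by move=> n; exact: normr_ge0.
  - by move=> n; exact: le_trans (normr_ge0 _) (h n).
  - exact: (is_cvg_seriesZ (f := rate) (k := M) cvg_series_rate).
have -> : u = (fun n => u 0 + series (fun n => u n.+1 - u n) n).
  apply/funext => n; elim: n => [|n IH]; first by rewrite /series /= big_geq // addr0.
  by rewrite seriesSr addrA -IH; ring.
by apply: is_cvgD => //; exact: is_cvg_cst.
Qed.

(** [prod (1 + |e n|) <= exp (sum |e n|)], and the sum of [rate] is at most 1. *)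
Lemma bounded_of_ratio (u e : nat -> R[i]) (K : R) :
  (forall n, u n.+1 = u n * (1 + e n)) ->
  (forall n, normc (e n) <= K * rate n) ->
  forall n, normc (u n) <= normc (u 0) * expR K.
Proof.
move=> ue eK.
have K0 : 0 <= K.
  have r0 : 0 < rate 0 by rewrite /rate invr_gt0 mulr_gt0 ?ltr0n.
  rewrite -(pmulr_lge0 _ r0); apply: le_trans (eK 0).
  exact: normc_ge0.
have bd n : normc (u n) <= normc (u 0) * expR (K * series rate n).
  elim: n => [|n IH].
    by rewrite /series /= big_geq // mulr0 expR0 mulr1.
  rewrite ue normcM seriesSr mulrDr expRD mulrA.
  apply: ler_pM; rewrite ?normc_ge0 //.
  apply: le_trans (normcD_le _ _) _; rewrite normc1.
  by apply: le_trans (expR_ge1Dx _); rewrite lerD2l.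
move=> n; apply: le_trans (bd n) _; apply: ler_wpM2l; first exact: normc_ge0.
by rewrite ler_expR series_rate ler_piMr // gerBl invr_ge0.
Qed.

(** The sequence being bounded, its increments [u n * e n] are dominated by a
    summable series. *)
Lemma cvg_of_ratio (u e : nat -> R[i]) (K : R) :
  (forall n, u n.+1 = u n * (1 + e n)) ->
  (forall n, normc (e n) <= K * rate n) ->
  exists l : R[i], (u : nat -> R[i]^o) @ \oo --> (l : R[i]^o).
Proof.
move=> ue eK; pose M := normc (u 0) * expR K * K.
have d n : normc (u n.+1 - u n) <= M * rate n.
  have -> : u n.+1 - u n = u n * e n by rewrite ue; ring.
  rewrite normcM /M -mulrA; apply: ler_pM => //.
  - exact: normc_ge0.
  - exact: normc_ge0.
  - exact: bounded_of_ratio ue eK n.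
have Re_le (z : R[i]) : `|complex.Re z| <= normc z.
  by have := normc_ge_Re z; rewrite lecR.
have Im_le (z : R[i]) : `|complex.Im z| <= normc z.
  by case: z => a b /=; rewrite -sqrtr_sqr ler_sqrt ?addr_ge0 ?sqr_ge0 // lerDr sqr_ge0.
have /cvg_ex[a ua] : cvgn (fun n => complex.Re (u n)).
  apply: (@is_cvg_of_summable_diff _ M) => n; apply: le_trans (d n).
  by rewrite -raddfB; exact: Re_le.
have /cvg_ex[b ub] : cvgn (fun n => complex.Im (u n)).
  apply: (@is_cvg_of_summable_diff _ M) => n; apply: le_trans (d n).
  by rewrite -raddfB; exact: Im_le.
by exists (a +i* b); exact: cvg_complex ua ub.
Qed.

(** Once [|e n| <= 1 / 2], the inverse sequence has ratios of the same kind, with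
    [K] doubled; hence it converges too, and the two limits are inverse to each
    other. *)
Lemma cvg_neq0_of_ratio (u e : nat -> R[i]) (K : R) (N : nat) :
  (forall n, u n != 0) ->
  (forall n, u n.+1 = u n * (1 + e n)) ->
  (forall n, (N <= n)%N -> normc (e n) <= K * rate n) ->
  exists2 l : R[i], l != 0 & (u : nat -> R[i]^o) @ \oo --> (l : R[i]^o).
Proof.
move=> u0 ue eK.
have r0 n : 0 < rate n by rewrite /rate invr_gt0 mulr_gt0 ?ltr0n.
have rdec n m : rate (n + m) <= rate n.
  rewrite /rate lef_pV2 ?posrE ?mulr_gt0 ?ltr0n //.
  by rewrite -!natrM ler_nat leq_mul // !ltnS leq_addr.
have K0 : 0 <= K.
  rewrite -(pmulr_lge0 _ (r0 N)); apply: le_trans (eK N (leqnn _)); exact: normc_ge0.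
pose n0 := maxn N (Num.truncn (2 * K)).
have half n : (n0 <= n)%N -> K * rate n <= 1 / 2.
  move=> hn; have : 2 * K < n.+1%:R.
    apply: (lt_le_trans (truncnS_gt _)); rewrite ler_nat ltnS.
    exact: leq_trans (leq_maxr _ _) hn.
  have : 1 <= n.+2%:R :> R by rewrite ler1n.
  have n10 : 0 < n.+1%:R :> R by rewrite ltr0n.
  have n20 : 0 < n.+2%:R :> R by rewrite ltr0n.
  by rewrite /rate ler_pdivrMr ?mulr_gt0 // => *; nra.
pose v n := u (n + n0)%N.
have ev n : normc (e (n + n0)) <= K * rate n.
  apply: le_trans (eK _ _) _; first exact: leq_trans (leq_maxl _ _) (leq_addl _ _).
  by rewrite ler_wpM2l.
have [l vl] : exists l : R[i], (v : nat -> R[i]^o) @ \oo --> (l : R[i]^o).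
  by apply: (@cvg_of_ratio v (fun n => e (n + n0)%N) K) => // n; rewrite /v addSn ue.
have [l' vl'] : exists l : R[i],
    ((fun n => (v n)^-1) : nat -> R[i]^o) @ \oo --> (l : R[i]^o).
  apply: (@cvg_of_ratio _ (fun n => (1 + e (n + n0)%N)^-1 - 1) (2 * K)) => n.
    by rewrite /v addSn ue invfM (addrC 1 (_ - 1)) subrK.
  have n1 : 1 / 2 <= normc (1 + e (n + n0)%N).
    have := normcD_le (1 + e (n + n0)%N) (- e (n + n0)%N).
    rewrite addrK normc1 normc_opp => h1.
    have := le_trans (eK _ (leq_trans (leq_maxl _ _) (leq_addl n n0)))
      (half _ (leq_addl n n0)).
    by move=> h2; lra.
  have ne0 : 1 + e (n + n0)%N != 0.
    by apply/negP => /eqP h; move: n1; rewrite h normc0; lra.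
  have -> : (1 + e (n + n0)%N)^-1 - 1 = (1 + e (n + n0)%N)^-1 * - e (n + n0)%N.
    by apply: (mulfI ne0); rewrite mulrBr mulrA mulfV //; ring.
  rewrite normcM normc_opp normcV mulrC mulrAC ler_pdivrMr; last by lra.
  have := ev n; have := normc_ge0 (e (n + n0)%N); have := r0 n.
  nra.
exists l; last by move: vl; rewrite (@cvg_shiftn n0 (R[i]^o) u).
by apply: (cvg_neq0_of_inv _ vl vl') => n; exact: u0.
Qed.

End ComplexSequences.

(** * Gauss' limit for the Gamma function *)

Section Gamma.
Variable R : realType.
Implicit Types s v x y t : R.

Lemma abs_expR_sub1 s : `|expR s - 1| <= `|s| * expR `|s|.
Proof.
have h1 := expR_ge1Dx s; have h2 := expR_ge1Dx (- s).
have := expRxMexpNx_1 s; have := expR_gt0 s; have := expR_gt0 (- s).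
case: (ger0P s) => hs *; rewrite ler_norml; apply/andP; split; nra.
Qed.

Lemma abs_expR_taylor1 s : `|expR s - 1 - s| <= s ^+ 2 * expR `|s|.
Proof.
have h1 := expR_ge1Dx s; have h2 := expR_ge1Dx (- s).
have := expRxMexpNx_1 s; have := expR_gt0 s; have := expR_gt0 (- s).
have e1 : 1 <= expR `|s| by apply: le_trans (expR_ge1Dx _); rewrite lerDl.
rewrite ger0_norm; last by lra.
move: e1; case: (ger0P s) => hs *.
  have : expR s - 1 <= s * expR s by nra.
  nra.
have : expR s <= 1 by rewrite expR_le1 ltW.
nra.
Qed.

Lemma abs_sin_le v : `|sin v| <= `|v|.
Proof.
wlog v0 : v / 0 <= v.
  move=> h; have [hv|hv] := leP 0 v; first exact: h.
  by have := h (- v); rewrite sinN !normrN; apply; lra.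
have [c _] : exists2 c, c \in `[0, v]%R & sin v - sin 0 = cos c * (v - 0).
  apply: MVT_segment => //.
  by apply: continuous_subspaceT; exact: continuous_sin.
rewrite sin0 !subr0 => ->.
by rewrite normrM ler_piMl // cos_max.
Qed.

Lemma one_sub_cos_le v : 0 <= 1 - cos v <= v ^+ 2.
Proof.
rewrite subr_ge0 cos_le1 /=.
have -> : v = (v / 2) *+ 2 by field.
rewrite cos_mulr2n cos2sin2.
have : sin (v / 2) ^+ 2 <= (v / 2) ^+ 2.
  rewrite -[leLHS]real_normK ?num_real // -[leRHS]real_normK ?num_real //.
  by rewrite lerXn2r ?nnegrE // abs_sin_le.
have := sqr_ge0 (v / 2).
nra.
Qed.

Lemma abs_sin_taylor1 v : `|sin v - v| <= v ^+ 2.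
Proof.
wlog v0 : v / 0 <= v.
  move=> h; have [hv|hv] := leP 0 v; first exact: h.
  have := h (- v); rewrite sinN sqrrN -opprD normrN; apply; lra.
have [c /itvP c0v] : exists2 c, c \in `[0, v]%R &
    (sin v - v) - (sin 0 - 0) = (cos c - 1) * (v - 0).
  apply: (@MVT_segment R (fun x => sin x - x) (fun x => cos x - 1)) => //.
  by apply: continuous_subspaceT => x; apply: cvgB; [exact: continuous_sin|exact: cvg_id].
rewrite sin0 !subr0 => ->.
rewrite normrM (ger0_norm v0) expr2 ler_wpM2r // distrC.
have -> : c = (c / 2) *+ 2 by field.
rewrite cos_mulr2n cos2sin2.
have c0 : 0 <= c by rewrite c0v.
have cv : c <= v by rewrite c0v.
have hs : `|sin (c / 2)| <= c / 2.
  by apply: le_trans (abs_sin_le _) _; rewrite ger0_norm // divr_ge0.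
have h1 := sin_max (c / 2); have h0 := normr_ge0 (sin (c / 2)).
rewrite (_ : 1 - _ = 2 * `|sin (c / 2)| ^+ 2); last first.
  by rewrite real_normK ?num_real //; ring.
by rewrite ger0_norm ?mulr_ge0 ?sqr_ge0 //; nra.
Qed.

(** This is [exp (z t)] for a real [t]; [natpowC n z] is its value at
    [t = ln n]. *)
Definition cexp (z : R[i]) (t : R) : R[i] :=
  (expR (complex.Re z * t))%:C
  * (cos (complex.Im z * t) +i* sin (complex.Im z * t)).

Lemma cexp_taylor1 (z : R[i]) : exists K : R, forall t, 0 <= t <= 1 ->
  normc (cexp z t - 1 - z * t%:C) <= K * t ^+ 2.
Proof.
case: z => x y.
exists (expR `|x| * (x ^+ 2 + y ^+ 2 + y ^+ 2 + `|x * y|)) => t /andP[t0 t1].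
rewrite /cexp /=; simpc.
apply: le_trans (normc_le _ _) _.
have et : expR `|x * t| <= expR `|x|.
  by rewrite ler_expR normrM (ger0_norm t0) ler_piMr.
have et' : expR (x * t) <= expR `|x| by apply: le_trans et; rewrite ler_expR ler_norm.
have h1 : `|expR (x * t) * cos (y * t) - 1 - x * t|
    <= expR `|x| * (x ^+ 2 + y ^+ 2) * t ^+ 2.
  rewrite (_ : _ - _ = (expR (x * t) - 1 - x * t)
      - expR (x * t) * (1 - cos (y * t))); last by ring.
  apply: le_trans (ler_normB _ _) _.
  rewrite (mulrDr (expR `|x|)) mulrDl lerD //.
    apply: le_trans (abs_expR_taylor1 _) _.
    by rewrite exprMn mulrC mulrA ler_wpM2r ?sqr_ge0 // ler_wpM2r ?sqr_ge0.
  have /andP[c0 c1] := one_sub_cos_le (y * t).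
  rewrite normrM (ger0_norm (expR_ge0 _)) (ger0_norm c0) -mulrA -exprMn.
  by rewrite ler_pM // expR_ge0.
have h2 : `|expR (x * t) * sin (y * t) - y * t|
    <= expR `|x| * (y ^+ 2 + `|x * y|) * t ^+ 2.
  rewrite (_ : _ - _ = expR (x * t) * (sin (y * t) - y * t)
      + (expR (x * t) - 1) * (y * t)); last by ring.
  apply: le_trans (ler_normD _ _) _.
  rewrite (mulrDr (expR `|x|)) mulrDl lerD //.
    rewrite normrM (ger0_norm (expR_ge0 _)) -mulrA -exprMn.
    by rewrite ler_pM ?expR_ge0 // abs_sin_taylor1.
  rewrite normrM; apply: (@le_trans _ _ (`|x * t| * expR `|x * t| * `|y * t|)).
    by rewrite ler_wpM2r // abs_expR_sub1.
  rewrite mulrAC -normrM (_ : x * t * (y * t) = x * y * t ^+ 2); last by ring.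
  rewrite normrM (ger0_norm (sqr_ge0 t)) mulrC -[leRHS]mulrA.
  by rewrite ler_wpM2r ?mulr_ge0 ?sqr_ge0.
apply: le_trans (lerD h1 h2) _.
by rewrite -mulrDl -mulrDr addrA.
Qed.

Lemma cexpD (z : R[i]) s t : cexp z (s + t) = cexp z s * cexp z t.
Proof.
rewrite /cexp !mulrDr expRD cosD sinD; simpc.
by congr (_ +i* _); ring.
Qed.

Lemma cexpDl (z w : R[i]) t : cexp (z + w) t = cexp z t * cexp w t.
Proof.
case: z w => [a b] [c d]; rewrite /cexp /= !mulrDl expRD cosD sinD; simpc.
by congr (_ +i* _); ring.
Qed.

Lemma cexp0 (z : R[i]) : cexp z 0 = 1.
Proof. by rewrite /cexp !mulr0 expR0 cos0 sin0; simpc. Qed.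

Lemma cexp_neq0 (z : R[i]) t : cexp z t != 0.
Proof.
apply/negP => /eqP h; have := cexpD z t (- t).
by rewrite subrr cexp0 h mul0r => /eqP; rewrite oner_eq0.
Qed.

Lemma natpowCE n (z : R[i]) : natpowC n z = cexp z (ln n%:R).
Proof. by []. Qed.

(** The relative increment of Gauss' sequence from index [m + 1] to [m + 2]. *)
Definition gauss_dev (z : R[i]) (m : nat) : R[i] :=
  (cexp z (ln m.+2%:R - ln m.+1%:R) - 1 - z * (m.+2%:R^-1)%:C)
  / (1 + z * (m.+2%:R^-1)%:C).

Lemma gauss_seqS (z : R[i]) (m : nat) : (forall k, z + k%:R != 0) ->
  gauss_seq z m.+2 = gauss_seq z m.+1 * (1 + gauss_dev z m).
Proof.
move=> zk; rewrite /gauss_seq /gauss_dev !natpowCE.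
have -> : cexp z (ln m.+2%:R) = cexp z (ln m.+2%:R - ln m.+1%:R) * cexp z (ln m.+1%:R).
  by rewrite -cexpD subrK.
rewrite big_nat_recr //= factS natrM fmorphV rmorph_nat.
have m20 : m.+2%:R != 0 :> R[i] by rewrite pnatr_eq0.
have P0 : \prod_(0 <= k < m.+2) (z + k%:R) != 0.
  by rewrite prodf_seq_neq0; apply/allP => k _; rewrite zk.
have z0 := zk m.+2.
have z1 : 1 + z * m.+2%:R^-1 != 0.
  have -> : 1 + z / m.+2%:R = (z + m.+2%:R) / m.+2%:R.
    by rewrite mulrDl mulfV // addrC.
  by rewrite mulf_neq0 ?invr_eq0.
move: (m.+2%:R : R[i]) m20 z0 z1 => a a0 za za1.
set E := cexp z (_ - _); set F := cexp z (ln _).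
have -> : 1 + (E - 1 - z / a) / (1 + z / a) = E * a / (z + a).
  by field; rewrite za a0.
move: (\prod_(0 <= k < m.+2) (z + k%:R)) ((m.+1)`!%:R : R[i]) P0 => P c P0.
by field; rewrite za P0.
Qed.

(** With [t = ln (m + 2) - ln (m + 1)] and [w = 1 / (m + 2)], the numerator
    [exp (z t) - 1 - z w] is [O(t ^ 2) + z (t - w)].  Both terms are of order
    [rate m], because [w <= t <= 1 / (m + 1)]. *)
Lemma gauss_dev_le (z : R[i]) : exists K : R, exists N, forall m, (N <= m)%N ->
  normc (gauss_dev z m) <= K * rate R m.
Proof.
have [K1 K1P] := cexp_taylor1 z.
have K10 : 0 <= K1.
  have := K1P 1; rewrite ler01 lexx expr1n mulr1 => /(_ isT).
  exact: le_trans (normc_ge0 _).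
pose N := Num.truncn (2 * normc z).
exists (2 * (2 * K1 + normc z)), N => m Nm.
have m10 : 0 < m.+1%:R :> R by rewrite ltr0n.
have m20 : 0 < m.+2%:R :> R by rewrite ltr0n.
rewrite /gauss_dev; set t := ln m.+2%:R - ln m.+1%:R; set w := m.+2%:R^-1 : R.
have w0 : 0 < w by rewrite invr_gt0.
have tw : w <= t.
  rewrite /t -opprB lerNr -ln_div ?posrE //.
  have -> : m.+1%:R / m.+2%:R = 1 + - w :> R.
    apply: (mulIf (lt0r_neq0 m20)); rewrite divfK ?lt0r_neq0 // mulrBl mul1r.
    by rewrite /w mulVf ?lt0r_neq0 // -(natr1 m.+1) addrK.
  apply: le_ln1Dx; rewrite ltrN2 invf_lt1 // ltr1n //.
have t1 : t <= m.+1%:R^-1.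
  rewrite /t -ln_div ?posrE //.
  have -> : m.+2%:R / m.+1%:R = 1 + m.+1%:R^-1 :> R.
    by rewrite -(natr1 m.+1) mulrDl mulfV ?lt0r_neq0 // mul1r.
  apply: le_ln1Dx; apply: (@lt_trans _ _ 0); rewrite ?ltrN10 ?invr_gt0 //.
have rE : rate R m = m.+1%:R^-1 * w by rewrite /rate invfM.
have rB : rate R m = m.+1%:R^-1 - w by rewrite rateE.
have m1w : m.+1%:R^-1 <= 2 * w.
  rewrite /w ler_pdivlMr // mulrC ler_pdivrMr //.
  rewrite -(natr1 m.+1); have : 1 <= m.+1%:R :> R by rewrite ler1n.
  lra.
have t2 : t ^+ 2 <= 2 * rate R m.
  have i0 : 0 <= m.+1%:R^-1 :> R by rewrite invr_ge0.
  have t0 : 0 <= t by lra.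
  by rewrite rE expr2 mulrCA; apply: ler_pM => //; exact: le_trans t1 m1w.
have num : normc (cexp z t - 1 - z * w%:C) <= (2 * K1 + normc z) * rate R m.
  have -> : cexp z t - 1 - z * w%:C = (cexp z t - 1 - z * t%:C) + z * (t - w)%:C.
    have -> : (t - w)%:C = t%:C - w%:C by rewrite rmorphB.
    by move: (t%:C) (w%:C) (cexp z t) => T W E; ring.
  apply: le_trans (normcD_le _ _) _; rewrite mulrDl lerD //.
    apply: le_trans (K1P _ _) _; last by rewrite -[leRHS]mulrA [leRHS]mulrCA ler_wpM2l.
    apply/andP; split; first lra.
    by apply: le_trans t1 _; rewrite invf_le1 // ler1n.
  rewrite normcM ler_wpM2l ?normc_ge0 //.
  have -> : normc (t - w)%:C = t - w.
    by rewrite /= expr0n addr0 sqrtr_sqr ger0_norm // subr_ge0.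
  by rewrite rB lerB.
(* the bound on the denominator [1 + z w]: this is where [N <= m] is used *)
have zw : normc (z * w%:C) <= 1 / 2.
  rewrite normcM.
  have -> : normc w%:C = w by rewrite /= expr0n addr0 sqrtr_sqr gtr0_norm.
  have : 2 * normc z <= m.+2%:R.
    apply: ltW (lt_le_trans (truncnS_gt _) _); rewrite ler_nat ltnS.
    exact: leq_trans Nm (leqnSn m).
  rewrite /w => h; rewrite ler_pdivrMr //; lra.
have den : 1 / 2 <= normc (1 + z * w%:C).
  have := normcD_le (1 + z * w%:C) (- (z * w%:C)).
  rewrite addrK normc1 normc_opp; lra.
rewrite normcM normcV ler_pdivrMr; last by lra.
have := normc_ge0 (cexp z t - 1 - z * w%:C).
nra.
Qed.

Lemma GammaC_cvg (z : R[i]) : (forall k, z + k%:R != 0) ->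
  GammaC z != 0 /\ (gauss_seq z @ \oo --> (GammaC z : R[i]^o)).
Proof.
move=> zk; have [K [N KN]] := gauss_dev_le z.
have [l l0 gl] : exists2 l : R[i], l != 0 &
    (fun n => gauss_seq z n.+1 : R[i]^o) @ \oo --> (l : R[i]^o).
  apply: (@cvg_neq0_of_ratio R (fun n => gauss_seq z n.+1) (gauss_dev z) K N) => //.
    move=> n; rewrite /gauss_seq natpowCE; apply: mulf_neq0.
      by apply: mulf_neq0; rewrite ?cexp_neq0 // pnatr_eq0 -lt0n fact_gt0.
    by rewrite invr_eq0 prodf_seq_neq0; apply/allP => k _; rewrite zk.
  by move=> n; exact: gauss_seqS.
have gl' : gauss_seq z @ \oo --> (l : R[i]^o) by rewrite -(@cvg_shiftS (R[i]^o)).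
by rewrite /GammaC (cvg_lim (@norm_hausdorff _ _) gl').
Qed.

Lemma cvg_inv_natS : (fun n => n.+1%:R^-1 : R[i]^o) @ \oo --> (0 : R[i]^o).
Proof.
apply: cvg_complex.
  rewrite (_ : (fun n => _) = harmonic); first exact: cvg_harmonic.
  by apply/funext => n; rewrite /harmonic -(rmorph_nat (real_complex R)) -fmorphV.
rewrite (_ : (fun n => _) = fun=> 0); first exact: cvg_cst.
by apply/funext => n; rewrite -(rmorph_nat (real_complex R)) -fmorphV.
Qed.

(** [g_(n+1)(z + 1) = z g_(n+1)(z) / (1 + (z + 1) / (n + 1))] for Gauss' sequence
    [g]. *)
Lemma GammaCS (z : R[i]) : (forall k, z + k%:R != 0) ->
  GammaC (z + 1) = z * GammaC z.
Proof.
move=> zk; have [_ cz] := GammaC_cvg zk.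
have z1k k : z + 1 + k%:R != 0 by rewrite -addrA nat1r zk.
have [_ cz1] := GammaC_cvg z1k.
have gS n : gauss_seq (z + 1) n.+1 = z * gauss_seq z n.+1 * (1 + (z + 1) * n.+1%:R^-1)^-1.
  rewrite /gauss_seq !natpowCE cexpDl.
  have -> : cexp 1 (ln n.+1%:R) = n.+1%:R :> R[i].
    rewrite /cexp /= mul1r mul0r cos0 sin0 lnK ?posrE // mulr1.
    by rewrite -(rmorph_nat (real_complex R)).
  have n0 : n.+1%:R != 0 :> R[i] by rewrite pnatr_eq0.
  have z0 : z != 0 by have := zk 0; rewrite addr0.
  have zn : z + 1 + n.+1%:R != 0 := z1k n.+1.
  have P0 : \prod_(0 <= k < n.+2) (z + k%:R) != 0.
    by rewrite prodf_seq_neq0; apply/allP => k _; rewrite zk.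
  have -> : \prod_(0 <= k < n.+2) (z + 1 + k%:R) =
      \prod_(0 <= k < n.+2) (z + k%:R) * (z + 1 + n.+1%:R) / z.
    have h1 : \prod_(0 <= k < n.+3) (z + k%:R) =
        \prod_(0 <= k < n.+2) (z + k%:R) * (z + n.+2%:R) by rewrite big_nat_recr.
    have h2 : \prod_(0 <= k < n.+3) (z + k%:R) =
        z * \prod_(0 <= k < n.+2) (z + 1 + k%:R).
      rewrite big_nat_recl //= addr0; congr (_ * _).
      by apply: eq_bigr => k _; rewrite -addrA nat1r.
    apply: (mulfI z0); rewrite -h2 h1 mulrCA mulfV // mulr1.
    by rewrite -[z + 1 + _]addrA nat1r.
  have -> : 1 + (z + 1) / n.+1%:R = (z + 1 + n.+1%:R) / n.+1%:R.
    by rewrite [RHS]mulrDl mulfV // addrC.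
  move: (n.+1%:R : R[i]) n0 zn => a a0 za.
  by field; rewrite a0 za P0 z0.
exact: (lim_of_shift_quotient cz cz1 cvg_inv_natS gS).
Qed.

End Gamma.

(** * The entries of the product of two Lax operators *)

Section Intertwining.
Variable R : realType.
Local Notation C := R[i].
Local Notation P := (poly2 R).
Local Notation x := (z12 R).
Local Notation y := (zvar R 1).
Implicit Types (p q : P) (a b c u v l s : C).

(** [dx] and [dy] are the partial derivatives in the coordinates [(z_12, z_2)]:
    [d_1 + d_2] kills [z_12]. *)
Definition dx p : P := mderiv 0 p.
Definition dy p : P := mderiv 0 p + mderiv 1 p.

Definition euler c p : P := x * dx p + c *: p.

(** Exchanging [u2] and [v2] in the entries below changes the parameter that goes
    with the shift of the eigenvalue, and a common shift of all the parameters
    changes the other one; hence two independent parameters. *)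
Definition raise a b p : P := y * euler a p + x * euler b p.
Definition lower a b p : P := euler a (dx p) - euler b (dy p).

Lemma mderiv_zvar (i j : 'I_2) : mderiv i (zvar R j) = mpolyC 2 (i == j)%:R.
Proof.
rewrite /zvar mderivX mnm1E eq_sym; case: eqP => [->|_]; last by rewrite scale0r mpolyC0.
have -> : mnm_sub (mnm1 j) (mnm1 j) = mnm0 by apply/mnmP => k; rewrite mnmBE mnm0E subnn.
by rewrite mpolyX0 scale1r mpolyC1.
Qed.

Definition diffE := (mderivD, mderivB, mderivN, mderivM, mderiv_mulC, mderivC,
  mderiv_zvar, mpolyC1, mpolyC0).

Lemma mderiv10 p : mderiv 1 (mderiv 0 p) = mderiv 0 (mderiv 1 p).
Proof. exact: mderiv_comm. Qed.

Lemma opmx_mulE (A B : 'M[operator R]_2) i k p :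
  opmx_mul A B i k p = A i 0 (B 0 k p) + A i 1 (B 1 k p).
Proof.
rewrite mxE big_ord_recl big_ord1; congr (_ + A i _ (B _ k p)); exact: val_inj.
Qed.

Section Mul.
Variables (A B C' D A' B' C'' D' : operator R) (p : P).
Let M := opmx_mul (opmx2 A B C' D) (opmx2 A' B' C'' D').

Lemma opmx2_mul00 : M 0 0 p = A (A' p) + B (C'' p).
Proof. by rewrite /M opmx_mulE !mxE. Qed.

Lemma opmx2_mul01 : M 0 1 p = A (B' p) + B (D' p).
Proof. by rewrite /M opmx_mulE !mxE. Qed.

Lemma opmx2_mul10 : M 1 0 p = C' (A' p) + D (C'' p).
Proof. by rewrite /M opmx_mulE !mxE. Qed.

Lemma opmx2_mul11 : M 1 1 p = C' (B' p) + D (D' p).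
Proof. by rewrite /M opmx_mulE !mxE. Qed.

End Mul.

(* The identities below hold with the derivatives of [p], the variables and the
   constants as independent indeterminates. *)
Ltac ring_entry p :=
  let D0 := fresh in let D1 := fresh in let D00 := fresh in let D01 := fresh in
  move: (mderiv 0 (mderiv 0 p)) (mderiv 0 (mderiv 1 p)) => D00 D01;
  move: (mderiv 0 p) (mderiv 1 p) (zvar R 0) (zvar R 1) => D0 D1 ? ?;
  repeat match goal with |- context [mpolyC 2 ?u] => move: (mpolyC 2 u) => ? end;
  ring.

Section Entries.
Variables u1 u2 v1 v2 : C.
Let LL := opmx_mul (Lax 0 u1 u2) (Lax 1 v1 v2).

Lemma entry01 p : LL 0 1 p = lower (u1 - v2) u1 p.
Proof.
apply: etrans (opmx2_mul01 _ _ _ _ _ _ _ _ _) _; cbv beta.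
rewrite /lower /euler /dx /dy /z12.
rewrite -!mul_mpolyC !diffE ?mpolyCM ?mpolyCB ?mderiv10.
ring_entry p.
Qed.

Lemma entry00 p : LL 0 0 p = v1 *: euler u1 p - y * lower (u1 - v2) u1 p.
Proof.
apply: etrans (opmx2_mul00 _ _ _ _ _ _ _ _ _) _; cbv beta.
rewrite /lower /euler /dx /dy /z12.
rewrite -!mul_mpolyC !diffE ?mpolyCM ?mpolyCB ?mderiv10.
ring_entry p.
Qed.

(** The lower right entry, split into terms that functions of [D] intertwine one
    by one. *)
Definition corner p : P :=
  y * euler (u1 - v2) (dx p) + x * euler (u1 - u2 - v2) (dx p) + (u2 * v2) *: p
  - raise u1 (u1 - u2) (dy p).

Lemma entry11 p : LL 1 1 p = corner p.
Proof.
apply: etrans (opmx2_mul11 _ _ _ _ _ _ _ _ _) _; cbv beta.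
rewrite /corner /raise /lower /euler /dx /dy /z12.
rewrite -!mul_mpolyC !diffE ?mpolyCM ?mpolyCB ?mderiv10.
ring_entry p.
Qed.

Lemma entry10 p : LL 1 0 p = v1 *: raise u1 (u1 - u2) p - y * corner p.
Proof.
apply: etrans (opmx2_mul10 _ _ _ _ _ _ _ _ _) _; cbv beta.
rewrite /corner /raise /lower /euler /dx /dy /z12.
rewrite -!mul_mpolyC !diffE ?mpolyCM ?mpolyCB ?mderiv10.
ring_entry p.
Qed.

End Entries.

Lemma opmx_intertwineE (T : operator R) (A B : 'M[operator R]_2) :
  opmx_scalel T A = opmx_scaler B T <-> forall i j p, T (A i j p) = B i j (T p).
Proof.
split=> [/matrixP AB i j p | AB].
  by have := congr1 (fun F : operator R => F p) (AB i j); rewrite !mxE.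
by apply/matrixP => i j; rewrite !mxE; apply/funext => p; exact: AB.
Qed.

Lemma ord2P (i : 'I_2) : i = 0 \/ i = 1.
Proof. by case: i => [[|[|//]] ?]; [left | right]; apply: val_inj. Qed.

(** * Functions of the Euler operator solve the equations *)

Lemma dx_linear : linear dx.
Proof. by move=> a p q; rewrite /dx mderivD mderivZ. Qed.

Lemma dy_linear : linear dy.
Proof. by move=> a p q; rewrite /dy !mderivD !mderivZ scalerDr addrACA. Qed.

Lemma euler_linear c : linear (euler c).
Proof.
move=> a p q; rewrite /euler dx_linear -!mul_mpolyC.
move: (dx p) (dx q) (mpolyC 2 a) (mpolyC 2 c) (z12 R) => ? ? ? ? ?; ring.
Qed.

Lemma eulerZ c a p : euler c (a *: p) = a *: euler c p.
Proof.
have e0 : euler c 0 = 0 :> P by rewrite /euler /dx raddf0 mulr0 scaler0 addr0.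
by have := euler_linear c a p 0; rewrite e0 !addr0.
Qed.

Lemma mulz_linear z : linear (fun p => z * p : P).
Proof.
move=> a p q; rewrite -!mul_mpolyC; move: (mpolyC 2 a) => ?; ring.
Qed.

Lemma mpolyX_zvar m : mpolyX C m = zvar R 0 ^+ m 0 * zvar R 1 ^+ m 1.
Proof.
rewrite mpolyXE_id big_ord_recl big_ord1 /zvar.
congr (_ * mpolyX _ (mnm1 _) ^+ m _); exact: val_inj.
Qed.

Lemma coords_zvarK j k :
  comp_mpoly [tuple x; y] (z12_coords (zvar R 0 ^+ j * y ^+ k))
  = zvar R 0 ^+ j * y ^+ k.
Proof.
rewrite /z12_coords rmorphM !rmorphXn /= !comp_mpolyXU /=.
rewrite rmorphM !rmorphXn rmorphD /= !comp_mpolyXU /=.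
by rewrite /z12 subrK.
Qed.

(** Substituting [z_1 := z_12] undoes the substitution [z_1 := z_1 + z_2]. *)
Lemma coordsK p : comp_mpoly [tuple x; y] (z12_coords p) = p.
Proof.
elim/mpolyind: p => [|c m p _ _ IH].
  by rewrite /z12_coords !comp_mpoly0.
rewrite /z12_coords (comp_mpolyD _ (_ *: _) p) comp_mpolyZ.
rewrite (comp_mpolyD _ (_ *: _) (comp_mpoly _ p)) comp_mpolyZ.
congr (_ + _); last exact: IH.
congr (_ *: _); rewrite mpolyX_zvar; exact: coords_zvarK.
Qed.

Lemma basis_expand p : p = \sum_(m <- msupp (z12_coords p))
  mcoeff m (z12_coords p) *: (y ^+ (m 1) * x ^+ (m 0)).
Proof.
rewrite -[LHS]coordsK {1}[z12_coords p]mpolyE raddf_sum; apply: eq_bigr => m _.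
apply: etrans (comp_mpolyZ _ _ _) _; congr (_ *: _).
by rewrite mpolyX_zvar rmorphM !rmorphXn /= !comp_mpolyXU /= mulrC.
Qed.

(** Identities between linear operators can be checked on the eigenbasis of [D]. *)
Lemma basis_ind (S : P -> Prop) :
  (forall a p q, S p -> S q -> S (a *: p + q)) ->
  (forall j k, S (y ^+ j * x ^+ k)) -> forall p, S p.
Proof.
move=> Slin Sbase p; rewrite (basis_expand p).
have S0 : S 0 by have := Slin (- 1) _ _ (Sbase 0 0) (Sbase 0 0); rewrite scaleN1r addNr.
elim: (msupp _) => [|m s IH]; first by rewrite big_nil.
by rewrite big_cons; apply: Slin.
Qed.

Lemma eulerE c j k : euler c (y ^+ j * x ^+ k) = (k%:R + c) *: (y ^+ j * x ^+ k).
Proof. by rewrite /euler /dx z12d1E scalerDl. Qed.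

Lemma mderivXn (i : 'I_2) n q :
  mderiv i (q ^+ n) = mpolyC 2 n%:R * (q ^+ n.-1 * mderiv i q).
Proof.
rewrite mul_mpolyC scaler_nat; elim: n => [|n IH].
  by rewrite expr0 mulr0n -mpolyC1 mderivC.
rewrite exprS mderivM IH /=; case: n {IH} => [|n] /=.
  by rewrite expr0 mulr1 mulr0n mulr0 addr0 mul1r.
by rewrite mulrnAr mulrA -exprS mulrC -mulrS.
Qed.

Lemma mderiv_z12 (i : 'I_2) : mderiv i x = mpolyC 2 ((i == 0)%:R - (i == 1)%:R).
Proof. by rewrite /z12 mderivB !mderiv_zvar mpolyCB. Qed.

Lemma dx_basis j k : dx (y ^+ j * x ^+ k) = k%:R *: (y ^+ j * x ^+ k.-1).
Proof.
rewrite /dx mderivM !mderivXn mderiv_zvar mderiv_z12 mpolyC0 subr0 mpolyC1 -mul_mpolyC.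
move: (y ^+ j) (y ^+ j.-1) (x ^+ k) (x ^+ k.-1) (mpolyC 2 k%:R) (mpolyC 2 j%:R) => *.
ring.
Qed.

Lemma dy_basis j k : dy (y ^+ j * x ^+ k) = j%:R *: (y ^+ j.-1 * x ^+ k).
Proof.
rewrite /dy !mderivM !mderivXn !mderiv_zvar !mderiv_z12 subr0 sub0r mpolyCN.
rewrite mpolyC0 !mpolyC1 -mul_mpolyC.
move: (y ^+ j) (y ^+ j.-1) (x ^+ k) (x ^+ k.-1) (mpolyC 2 k%:R) (mpolyC 2 j%:R) => *.
ring.
Qed.

(** [d_x D = (D + 1) d_x]; so [x (D + c) d_x] is a polynomial in [D], which
    every function of [D] commutes with. *)
Lemma x_euler_dx c p : x * euler c (dx p) = euler (c - 1) (euler 0 p).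
Proof.
rewrite /euler /dx /z12 -!mul_mpolyC !diffE ?mpolyCB ?mpolyC1 ?mpolyC0.
ring_entry p.
Qed.

Section FunctionsOfEuler.
Variable f : nat -> C.

HB.instance Definition _ :=
  GRing.isLinear.Build C P P *:%R (fun_z12d1 f) (fun_z12d1_is_linear f).
Local Notation F := (fun_z12d1 f).

Lemma fun_z12d1D p q : F (p + q) = F p + F q.
Proof. exact: raddfD. Qed.

Lemma fun_z12d1B p q : F (p - q) = F p - F q.
Proof. exact: raddfB. Qed.

Lemma fun_z12d1Z c p : F (c *: p) = c *: F p.
Proof. exact: linearZ. Qed.

Lemma fun_z12d1_intertwine (A A' : P -> P) : linear A -> linear A' ->
  (forall j k, F (A (y ^+ j * x ^+ k)) = f k *: A' (y ^+ j * x ^+ k)) ->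
  forall p, F (A p) = A' (F p).
Proof.
move=> lA lA' base; have A'Z a q : A' (a *: q) = a *: A' q.
  have A'0 : A' 0 = 0 by have := lA' (- 1) 0 0; rewrite scaler0 addr0 scaleN1r addNr.
  by have := lA' a q 0; rewrite A'0 !addr0.
apply: basis_ind => [a p q hp hq | j k]; last by rewrite base fun_z12d1E A'Z.
by rewrite lA (fun_z12d1_is_linear f a (A p)) (fun_z12d1_is_linear f a p) lA' hp hq.
Qed.

Lemma fun_z12d1_y p : F (y * p) = y * F p.
Proof.
apply: fun_z12d1_intertwine; [exact: mulz_linear | exact: mulz_linear | move=> j k].
by rewrite scalerAr mulrA -exprS fun_z12d1E -scalerAr mulrA -exprS.
Qed.

Lemma fun_z12d1_dy p : F (dy p) = dy (F p).
Proof.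
apply: fun_z12d1_intertwine; [exact: dy_linear | exact: dy_linear | move=> j k].
by rewrite dy_basis fun_z12d1Z fun_z12d1E !scalerA mulrC.
Qed.

Lemma fun_z12d1_euler c p : F (euler c p) = euler c (F p).
Proof.
apply: fun_z12d1_intertwine; [exact: euler_linear | exact: euler_linear | move=> j k].
by rewrite !eulerE fun_z12d1Z fun_z12d1E !scalerA mulrC.
Qed.

(** The recurrence is what makes [f(D)] compatible with the two operators that
    shift the eigenvalue by one. *)
Variables a b : C.
Hypothesis frec : forall k, f k.+1 * (k%:R + a) = f k * (k%:R + b).

Lemma fun_z12d1_x_euler p : F (x * euler a p) = x * euler b (F p).
Proof.
apply: (fun_z12d1_intertwine (A := fun p => x * euler a p)
  (A' := fun p => x * euler b p)).
- by move=> c q r; rewrite euler_linear mulz_linear.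
- by move=> c q r; rewrite euler_linear mulz_linear.
move=> j k; rewrite !eulerE -!scalerAr mulrCA -exprS fun_z12d1Z fun_z12d1E.
by rewrite !scalerA mulrC frec.
Qed.

Lemma fun_z12d1_euler_dx p : F (euler b (dx p)) = euler a (dx (F p)).
Proof.
apply: (fun_z12d1_intertwine (A := fun p => euler b (dx p))
  (A' := fun p => euler a (dx p))).
- by move=> c q r; rewrite dx_linear euler_linear.
- by move=> c q r; rewrite dx_linear euler_linear.
move=> j k; rewrite !dx_basis !eulerZ !eulerE fun_z12d1Z.
case: k => [|k]; first by rewrite !scale0r scaler0.
rewrite fun_z12d1Z fun_z12d1E !scalerA /=; congr (_ *: _).
by rewrite -mulrA (mulrC (_ + b)) -frec; ring.
Qed.

Lemma fun_z12d1_raise c p : F (raise c a p) = raise c b (F p).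
Proof.
by rewrite /raise fun_z12d1D fun_z12d1_y fun_z12d1_euler fun_z12d1_x_euler.
Qed.

Lemma fun_z12d1_lower c p : F (lower b c p) = lower a c (F p).
Proof.
by rewrite /lower fun_z12d1B fun_z12d1_euler_dx fun_z12d1_euler fun_z12d1_dy.
Qed.

End FunctionsOfEuler.

(** The terms [x (D + u1 - u2 - v2) d_x] and [u2 v2] are symmetric in [u2] and [v2]
    and commute with [f(D)]. *)
Lemma fun_z12d1_corner u1 u2 v2 (f : nat -> C) p :
  (forall k, f k.+1 * (k%:R + (u1 - u2)) = f k * (k%:R + (u1 - v2))) ->
  fun_z12d1 f (corner u1 u2 v2 p) = corner u1 v2 u2 (fun_z12d1 f p).
Proof.
move=> frec; rewrite /corner fun_z12d1B (fun_z12d1_raise frec) fun_z12d1_dy.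
congr (_ - _); rewrite 2!fun_z12d1D fun_z12d1_y (fun_z12d1_euler_dx frec).
rewrite fun_z12d1Z (mulrC u2) (addrAC u1 (- v2) (- u2)).
by rewrite (x_euler_dx _ p) (x_euler_dx _ (fun_z12d1 f p)) 2!fun_z12d1_euler.
Qed.

Lemma fun_z12d1_solves u1 u2 v1 v2 (f : nat -> C) :
  (forall k, f k.+1 * (k%:R + (u1 - u2)) = f k * (k%:R + (u1 - v2))) ->
  opmx_scalel (fun_z12d1 f) (opmx_mul (Lax 0 u1 u2) (Lax 1 v1 v2))
  = opmx_scaler (opmx_mul (Lax 0 u1 v2) (Lax 1 v1 u2)) (fun_z12d1 f).
Proof.
move=> frec; apply/opmx_intertwineE => i j p.
have [-> | ->] := ord2P i; have [-> | ->] := ord2P j.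
- apply: etrans (congr1 _ (entry00 _ _ _ _ _)) (etrans _ (esym (entry00 _ _ _ _ _))).
  by rewrite fun_z12d1B fun_z12d1Z fun_z12d1_y fun_z12d1_euler (fun_z12d1_lower frec).
- apply: etrans (congr1 _ (entry01 _ _ _ _ _)) (etrans _ (esym (entry01 _ _ _ _ _))).
  exact: fun_z12d1_lower.
- apply: etrans (congr1 _ (entry10 _ _ _ _ _)) (etrans _ (esym (entry10 _ _ _ _ _))).
  by rewrite fun_z12d1B fun_z12d1Z fun_z12d1_y (fun_z12d1_raise frec) fun_z12d1_corner.
- apply: etrans (congr1 _ (entry11 _ _ _ _ _)) (etrans _ (esym (entry11 _ _ _ _ _))).
  exact: fun_z12d1_corner.
Qed.

(** * Uniqueness of the intertwiner *)

Section Uniqueness.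
Variable T : {linear P -> P}.
Let TD p q : T (p + q) = T p + T q. Proof. exact: raddfD. Qed.
Let TB p q : T (p - q) = T p - T q. Proof. exact: raddfB. Qed.
Let TZ a p : T (a *: p) = a *: T p. Proof. exact: linearZ. Qed.

(** [T] is the same for [v1] and [v1 + 1], so the slopes in [v1] of the entries of
    the left column can be compared. *)
Lemma relations_of_intertwining u1 u2 v1 v2 :
  (forall v, v = v1 \/ v = v1 + 1 ->
    opmx_scalel T (opmx_mul (Lax 0 u1 u2) (Lax 1 v v2))
    = opmx_scaler (opmx_mul (Lax 0 u1 v2) (Lax 1 v u2)) T) ->
  [/\ forall p, T (lower (u1 - v2) u1 p) = lower (u1 - u2) u1 (T p),
      forall p, T (euler u1 p) = euler u1 (T p)
    & forall p, T (raise u1 (u1 - u2) p) = raise u1 (u1 - v2) (T p)].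
Proof.
move=> TL.
have L01 p : T (lower (u1 - v2) u1 p) = lower (u1 - u2) u1 (T p).
  have /opmx_intertwineE/(_ 0 1 p) E := TL v1 (or_introl erefl).
  exact: etrans (etrans (congr1 T (esym (entry01 _ _ _ _ p))) E) (entry01 _ _ _ _ _).
have L00 v p : v = v1 \/ v = v1 + 1 ->
    v *: T (euler u1 p) - T (y * lower (u1 - v2) u1 p) =
    v *: euler u1 (T p) - y * lower (u1 - u2) u1 (T p).
  move=> /TL /opmx_intertwineE/(_ 0 0 p) E.
  have := etrans (etrans (congr1 T (esym (entry00 _ _ _ _ p))) E) (entry00 _ _ _ _ _).
  by rewrite TB TZ.
have L10 v p : v = v1 \/ v = v1 + 1 ->
    v *: T (raise u1 (u1 - u2) p) - T (y * corner u1 u2 v2 p) =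
    v *: raise u1 (u1 - v2) (T p) - y * corner u1 v2 u2 (T p).
  move=> /TL /opmx_intertwineE/(_ 1 0 p) E.
  have := etrans (etrans (congr1 T (esym (entry10 _ _ _ _ p))) E) (entry10 _ _ _ _ _).
  by rewrite TB TZ.
(* subtracting the equations at [v1] and [v1 + 1] leaves exactly the slopes *)
have slope (A B A' B' : P) :
    (forall v, v = v1 \/ v = v1 + 1 -> v *: A - B = v *: A' - B') -> A = A'.
  move=> h; have h0 := h v1 (or_introl erefl); have h1 := h (v1 + 1) (or_intror erefl).
  move: h1; rewrite !scalerDl !scale1r ![_ *: _ + _]addrC -!addrA h0.
  exact: addIr.
split=> // p; first by apply: slope => v; exact: L00.
by apply: slope => v; exact: L10.
Qed.

(** The relations with [s = 1] come from shift invariance. *)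
Variables u1 u2 v2 : C.
Hypothesis T_lower : forall s, s = 0 \/ s = 1 -> forall p,
  T (lower (u1 - v2) (u1 + s) p) = lower (u1 - u2) (u1 + s) (T p).
Hypothesis T_euler : forall p, T (euler u1 p) = euler u1 (T p).
Hypothesis T_raise : forall s, s = 0 \/ s = 1 -> forall p,
  T (raise (u1 + s) (u1 - u2) p) = raise (u1 + s) (u1 - v2) (T p).

Lemma lowerDr a b p : lower a (b + 1) p = lower a b p - dy p.
Proof.
rewrite /lower /euler (scalerDl (dy p)) scale1r.
by rewrite (addrA (x * dx (dy p))) opprD addrA.
Qed.

Lemma raiseDl a b p : raise (a + 1) b p = raise a b p + y * p.
Proof. by rewrite /raise /euler scalerDl scale1r addrA mulrDr addrAC. Qed.

Lemma T_dy p : T (dy p) = dy (T p).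
Proof.
have := T_lower (or_introl erefl) p; rewrite addr0 => h0.
have := T_lower (or_intror erefl) p; rewrite (lowerDr _ _ p) (lowerDr _ _ (T p)) TB h0.
by move=> /addrI /oppr_inj.
Qed.

Lemma T_y p : T (y * p) = y * T p.
Proof.
have := T_raise (or_introl erefl) p; rewrite addr0 => h0.
have := T_raise (or_intror erefl) p; rewrite (raiseDl _ _ p) (raiseDl _ _ (T p)) TD h0.
by move=> /addrI.
Qed.

Lemma T_x_euler p : T (x * euler (u1 - u2) p) = x * euler (u1 - v2) (T p).
Proof.
have := T_raise (or_introl erefl) p; rewrite addr0 /raise TD T_y T_euler.
by move=> /addrI.
Qed.

Lemma T_xdx p : T (x * dx p) = x * dx (T p).
Proof.
by have := T_euler p; rewrite /euler TD TZ => /addIr.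
Qed.

Lemma constant_of_deriv0 q : dx q = 0 -> dy q = 0 -> q = mpolyC 2 (mcoeff mnm0 q).
Proof.
rewrite /dx /dy => q0; rewrite q0 add0r => q1.
apply/mpolyP => m; rewrite mcoeffC; have [->|m0] := eqVneq m mnm0.
  by rewrite mulr1.
rewrite mulr0; have [i mi] : exists i : 'I_2, m i != 0%N.
  apply/existsP; rewrite -negb_forall; apply: contra m0 => /forallP h.
  by apply/eqP/mnmP => i; rewrite mnm0E; apply/eqP.
have qi : mderiv i q = 0.
  by have [->|->] := ord2P i.
have := mcoeff_mderiv i q (mnm_sub m (mnm1 i)).
rewrite qi mcoeff0 submK; last by rewrite lep1mP.
by move/esym/eqP; rewrite mulrn_eq0 /= => /eqP.
Qed.

Lemma x_neq0 : x != 0.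
Proof.
apply/eqP => x0; have : mderiv 0 x = 0 by rewrite x0 raddf0.
rewrite mderiv_z12 subr0 mpolyC1 => /eqP; by rewrite oner_eq0.
Qed.

(** [T 1] is killed by [x d_x] and by [d_y]. *)
Lemma T_one : T 1 = mpolyC 2 (mcoeff mnm0 (T 1)).
Proof.
have D1 : dx (y ^+ 0) = 0 by rewrite /dx mderivXn mpolyC0 mul0r.
have Dy1 : dy (y ^+ 0) = 0 by rewrite /dy (mderivXn 0) (mderivXn 1) mpolyC0 !mul0r addr0.
rewrite expr0 in D1 Dy1.
apply: constant_of_deriv0; last by rewrite -T_dy Dy1 raddf0.
have := T_xdx 1; rewrite D1 mulr0 raddf0 => /esym/eqP.
by rewrite mulf_eq0 (negPf x_neq0) => /eqP.
Qed.

Variable f : nat -> C.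
Hypothesis f0 : f 0 != 0.
Hypothesis frec : forall k, f k.+1 * (k%:R + (u1 - u2)) = f k * (k%:R + (u1 - v2)).
Hypothesis ngen : forall k : nat, k%:R + (u1 - u2) != 0.

Lemma intertwiner_eq p : T p = (mcoeff mnm0 (T 1) / f 0) *: fun_z12d1 f p.
Proof.
set c := _ / _.
have Tx k : T (x ^+ k) = (c * f k) *: x ^+ k.
  elim: k => [|k IH].
    by rewrite expr0 T_one /c divfK // -mul_mpolyC mulr1.
  have := T_x_euler (x ^+ k); rewrite IH -[x ^+ k]mul1r -(expr0 y).
  rewrite eulerZ !eulerE expr0 mul1r -!scalerAr -!exprS TZ scalerA => h.
  apply: (scalerI (ngen k)); rewrite h scalerA; congr (_ *: _).
  by rewrite mulrCA [X in _ = _ * X]mulrC frec mulrA.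
move: p; apply: basis_ind => [a p q hp hq | j k].
  by rewrite TD TZ hp hq (fun_z12d1_is_linear f a p) scalerDr !scalerA (mulrC a).
rewrite fun_z12d1E scalerA; elim: j => [|j IH]; first by rewrite expr0 mul1r.
by rewrite exprS -mulrA T_y IH -scalerAr.
Qed.

End Uniqueness.

(** * Generic parameters *)

Definition nonint (z : C) := forall m : int, z != m%:~R.

Lemma nonint_Im (z : C) : complex.Im z != 0 -> nonint z.
Proof.
move=> Imz m; apply: contraNneq Imz => ->.
by rewrite -(rmorph_int (real_complex R)).
Qed.

Lemma nonintDn (z : C) (n : nat) : nonint z -> n%:R + z != 0.
Proof.
move=> zI; apply/eqP => nz; have /eqP := zI (- n%:Z); apply.
by rewrite mulrNz -[n%:~R]/(n%:R) -(addKr n%:R z) nz addr0.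
Qed.

Lemma generic3P u1 u2 v2 : generic [:: u1; u2; v2] <->
  [/\ nonint (u1 - u2), nonint (u1 - v2) & nonint (u2 - v2)].
Proof.
split=> [g | [h1 h2 h3]].
  by split; [exact: (g 0 1) | exact: (g 0 2) | exact: (g 1 2)].
by move=> [|[|[|i]]] [|[|[|j]]] //=; rewrite ?andbF.
Qed.

Lemma generic4P u1 u2 v1 v2 : generic [:: u1; u2; v1; v2] <->
  generic [:: u1; u2; v2]
  /\ [/\ nonint (u1 - v1), nonint (u2 - v1) & nonint (v1 - v2)].
Proof.
rewrite generic3P; split=> [g | [[h1 h2 h3] [h4 h5 h6]]].
  do 2?split; [exact: (g 0 1) | exact: (g 0 3) | exact: (g 1 3) | exact: (g 0 2) |
    exact: (g 1 2) | exact: (g 2 3)].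
by move=> [|[|[|[|i]]]] [|[|[|[|j]]]] //=; rewrite ?andbF.
Qed.

Lemma addrDBr a b l : a + l - (b + l) = a - b.
Proof. by rewrite opprD addrACA subrr addr0. Qed.

Lemma generic3D u1 u2 v2 l : generic [:: u1; u2; v2] ->
  generic [:: u1 + l; u2 + l; v2 + l].
Proof. by rewrite !generic3P !addrDBr. Qed.

(** A [v1] of large imaginary part stays generic when the parameters are shifted
    by integers. *)
Lemma exists_generic u1 u2 v2 : generic [:: u1; u2; v2] -> exists v1 : C,
  forall s l, (s = 0 \/ s = 1) -> (l = 0 \/ l = 1) ->
    generic [:: u1 + l; u2 + l; v1 + s; v2 + l].
Proof.
move=> g; pose B := `|complex.Im u1| + `|complex.Im u2| + `|complex.Im v2| + 1.
exists (0 +i* B) => s l s01 l01; apply/generic4P; split; first exact: generic3D.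
have s0 : complex.Im s = 0 by case: s01 => ->.
have l0 : complex.Im l = 0 by case: l01 => ->.
have h1 := ler_norm (complex.Im u1); have h2 := ler_norm (complex.Im u2).
have h3 := ler_norm (complex.Im v2); have h4 := normr_ge0 (complex.Im u1).
have h5 := normr_ge0 (complex.Im u2); have h6 := normr_ge0 (complex.Im v2).
have ImBD a b c d : complex.Im (a + b - (c + d)) =
  complex.Im a + complex.Im b - (complex.Im c + complex.Im d).
  by case: a b c d => ? ? [? ?] [? ?] [? ?].
split; apply: nonint_Im; rewrite ImBD s0 l0 /= !addr0 subr_eq0.
- by rewrite lt_eqF //; rewrite /B; lra.
- by rewrite lt_eqF //; rewrite /B; lra.
- by rewrite gt_eqF //; rewrite /B; lra.
Qed.

(** * The Gamma quotient *)

Definition gamma_ratio u1 u2 v2 (k : nat) : C :=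
  GammaC (k%:R + u1 - v2) / GammaC (k%:R + u1 - u2).

Lemma gamma_ratio0 u1 u2 v2 : generic [:: u1; u2; v2] -> gamma_ratio u1 u2 v2 0 != 0.
Proof.
case/generic3P => h1 h2 _; rewrite /gamma_ratio !add0r.
apply: mulf_neq0; rewrite ?invr_eq0; last first.
  by apply: (GammaC_cvg _).1 => k; rewrite addrC nonintDn.
by apply: (GammaC_cvg _).1 => k; rewrite addrC nonintDn.
Qed.

Lemma gamma_ratioS u1 u2 v2 k : generic [:: u1; u2; v2] ->
  gamma_ratio u1 u2 v2 k.+1 * (k%:R + (u1 - u2))
  = gamma_ratio u1 u2 v2 k * (k%:R + (u1 - v2)).
Proof.
case/generic3P => h1 h2 _; rewrite /gamma_ratio -!addrA.
have pole (z : C) j : nonint z -> (k%:R + z) + j%:R != 0.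
  by move=> zI; rewrite addrAC -natrD nonintDn.
have S (z : C) : nonint z -> GammaC (k.+1%:R + z) = (k%:R + z) * GammaC (k%:R + z).
  by move=> zI; rewrite -natr1 addrAC GammaCS // => j; exact: pole.
rewrite !S //.
have G0 : GammaC (k%:R + (u1 - u2)) != 0 by apply: (GammaC_cvg _).1 => j; exact: pole.
have k0 := nonintDn k h1.
by move: (k%:R + (u1 - u2)) G0 k0 (k%:R + (u1 - v2)) => a G0 k0 b; field; rewrite G0 k0.
Qed.

Lemma GammaQuotient_intertwines u1 u2 v1 v2 : generic [:: u1; u2; v1; v2] ->
  opmx_scalel (GammaQuotient u1 u2 v2) (opmx_mul (Lax 0 u1 u2) (Lax 1 v1 v2))
  = opmx_scaler (opmx_mul (Lax 0 u1 v2) (Lax 1 v1 u2)) (GammaQuotient u1 u2 v2).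
Proof.
case/generic4P => g _; apply: fun_z12d1_solves => k; exact: gamma_ratioS.
Qed.

(** The scalar is fixed by evaluation at the constant polynomial 1. *)
Lemma solution_unique (R2 : op_family R) :
  shift_invariant R2 -> solves_defining_equations R2 ->
  forall u1 u2 v2, generic [:: u1; u2; v2] -> forall p,
    R2 u1 u2 v2 p =
    (mcoeff mnm0 (R2 u1 u2 v2 1) / gamma_ratio u1 u2 v2 0) *: GammaQuotient u1 u2 v2 p.
Proof.
move=> shift solves u1 u2 v2 g; have [v1 v1P] := exists_generic g.
have rel l : l = 0 \/ l = 1 ->
  [/\ forall p, R2 u1 u2 v2 (lower (u1 - v2) (u1 + l) p) =
        lower (u1 - u2) (u1 + l) (R2 u1 u2 v2 p),
      forall p, R2 u1 u2 v2 (euler (u1 + l) p) = euler (u1 + l) (R2 u1 u2 v2 p)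
    & forall p, R2 u1 u2 v2 (raise (u1 + l) (u1 - u2) p) =
        raise (u1 + l) (u1 - v2) (R2 u1 u2 v2 p)].
  move=> l01; have E := shift _ _ _ g l.
  have [|h1 h2 h3] := @relations_of_intertwining (R2 (u1 + l) (u2 + l) (v2 + l))
      (u1 + l) (u2 + l) v1 (v2 + l).
    move=> v [-> | ->]; apply: solves; last exact: v1P (or_intror erefl) l01.
    by have := v1P 0 l (or_introl erefl) l01; rewrite addr0.
  rewrite !addrDBr in h1 h3.
  (* from the shifted parameters back to [u1, u2, v2] *)
  have descend (A A' : operator R) :
      (forall p, R2 (u1 + l) (u2 + l) (v2 + l) (A p)
        = A' (R2 (u1 + l) (u2 + l) (v2 + l) p)) ->
      forall p, R2 u1 u2 v2 (A p) = A' (R2 u1 u2 v2 p).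
    by move=> h p; exact: etrans (E _) (etrans (h p) (congr1 A' (esym (E p)))).
  split.
  - exact: (descend (lower (u1 - v2) (u1 + l)) (lower (u1 - u2) (u1 + l)) h1).
  - exact: (descend (euler (u1 + l)) (euler (u1 + l)) h2).
  - exact: (descend (raise (u1 + l) (u1 - u2)) (raise (u1 + l) (u1 - v2)) h3).
have [_ e0 _] := rel 0 (or_introl erefl); rewrite addr0 in e0.
have hl l l01 p : _ := let: And3 h _ _ := rel l l01 in h p.
have hr l l01 p : _ := let: And3 _ _ h := rel l l01 in h p.
have k0 k : k%:R + (u1 - u2) != 0 by case/generic3P: g => h _ _; exact: nonintDn.
move=> p.
exact: (intertwiner_eq (f := gamma_ratio u1 u2 v2) hl e0 hr (gamma_ratio0 g)
  (fun k => gamma_ratioS k g) k0 p).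
Qed.

End Intertwining.

Theorem proposition2 (R : realType) :
  (exists R2 : op_family R,
     [/\ nonzero_family R2,
         shift_invariant R2
       & solves_defining_equations R2])
  /\
  (forall R2 : op_family R,
     shift_invariant R2 ->
     solves_defining_equations R2 ->
     exists c : R[i] -> R[i] -> R[i] -> R[i],
       forall u1 u2 v2 : R[i], generic [:: u1; u2; v2] ->
         (nonzero_op (R2 u1 u2 v2) -> c u1 u2 v2 != 0)
         /\ forall p : poly2 R, R2 u1 u2 v2 p = c u1 u2 v2 *: GammaQuotient u1 u2 v2 p).
Proof.
split.
  exists (fun u1 u2 v2 => fun_z12d1 (gamma_ratio u1 u2 v2) : {linear _ -> _}).
  split.
  - move=> u1 u2 v2 g; exists (zvar R 1 ^+ 0 * z12 R ^+ 0).
    rewrite /= fun_z12d1E scaler_eq0 negb_or gamma_ratio0 //.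
    by rewrite !expr0 mulr1 oner_neq0.
  - move=> u1 u2 v2 g l p; congr (fun_z12d1 _ p); apply/funext => k.
    by rewrite /gamma_ratio -!(addrA k%:R) !addrDBr.
  - by move=> u1 u2 v1 v2; exact: GammaQuotient_intertwines.
move=> R2 shift solves.
exists (fun u1 u2 v2 => mcoeff mnm0 (R2 u1 u2 v2 1) / gamma_ratio u1 u2 v2 0).
move=> u1 u2 v2 g; split; last by move=> p; exact: solution_unique.
move=> [p]; rewrite (solution_unique shift solves g p).
by apply: contraNneq => ->; rewrite scale0r.
Qed.
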